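(* Let $R$ be a local number ring with maximal ideal $\mathfrak m$, residue field $k=R/\mathfrak m$ and normalization $\tilde R$. Then for every ideal $I$ of $R$ we have \[\dim_k \frac{I}{\mathfrak m I}\leq \dim_k \frac{\tilde R}{\mathfrak m\tilde R}.\]
   Context: A number ring is a subring of a number field (a finite extension of $\mathbb{Q}$); its normalization $\tilde R$ is its integral closure in its field of fractions. A local ring is a ring with a unique maximal ideal. *)

(* Defs.v *)
From HB Require Import structures.
From mathcomp Require Import all_boot all_order all_algebra all_field.
Set Implicit Arguments. Unset Strict Implicit. Unset Printing Implicit Defensive.
Import GRing.Theory.
Local Open Scope ring_scope.

(* A number field is modelled as L : fieldExtType rat (a finite field extension
   of Q).  Subsets of L are Prop-valued predicates L -> Prop. *)

Section NumberRings.
Variable L : fieldExtType rat.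

Definition is_subring (R : L -> Prop) : Prop :=
  [/\ R 0, R 1, (forall x y, R x -> R y -> R (x - y)),
      (forall x y, R x -> R y -> R (x + y)) &
      (forall x y, R x -> R y -> R (x * y))].

Definition ideal (R I : L -> Prop) : Prop :=
  [/\ (forall x, I x -> R x), I 0,
      (forall x y, I x -> I y -> I (x + y)) &
      (forall r x, R r -> I x -> I (r * x))].

Definition maximal_ideal (R m : L -> Prop) : Prop :=
  [/\ ideal R m, ~ m 1 &
      forall J, ideal R J -> (forall x, m x -> J x) ->
        (forall x, J x <-> m x) \/ J 1].

Definition is_local (R : L -> Prop) : Prop :=
  exists m, maximal_ideal R m /\
    forall m', maximal_ideal R m' -> forall x, m' x <-> m x.

Definition frac (R : L -> Prop) : L -> Prop :=
  fun x => exists a b, [/\ R a, R b, b != 0 & x = a / b].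

Definition integral_over (R : L -> Prop) (x : L) : Prop :=
  exists p : {poly L}, [/\ p \is monic, (forall i, R p`_i) & root p x].

Definition normalization (R : L -> Prop) : L -> Prop :=
  fun x => frac R x /\ integral_over R x.

Definition set_mul (A B : L -> Prop) : L -> Prop :=
  fun z => exists s : seq (L * L),
    (forall p, p \in s -> A p.1 /\ B p.2) /\ z = \sum_(p <- s) p.1 * p.2.

(* x_0, ..., x_{n-1} are elements of M whose classes in M / N are linearly
   independent over the residue field k = R / m (scalars of k represented by
   their lifts in R; the class of r is zero iff r is in m). *)
Definition indep_mod (R m M N : L -> Prop) (n : nat) (x : 'I_n -> L) : Prop :=
  (forall i, M (x i)) /\
  forall r : 'I_n -> L, (forall i, R (r i)) ->
    N (\sum_(i < n) r i * x i) -> forall i, m (r i).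

(* dim_k (M / m M) <= dim_k (M' / m M'), as (possibly infinite) dimensions:
   every independent family of size n in the first yields one in the second. *)
Definition dim_quot_le (R m M M' : L -> Prop) : Prop :=
  forall n (x : 'I_n -> L), indep_mod R m M (set_mul m M) x ->
    exists y : 'I_n -> L, indep_mod R m M' (set_mul m M') y.

End NumberRings.

(* Main.v *)
From HB Require Import structures.
From mathcomp Require Import all_boot all_order all_algebra all_field.
From mathcomp Require Import boolp classical_sets.
From mathcomp Require Import ring zify.
(* Last, so that [frac] is not the fraction-field construction of MathComp. *)
Require Import Defs.

(* Let S be the normalization of R and q the residue characteristic (when m = 0
   the ring R is a field and the bound is immediate).  All quotients involved
   are finite, so dimensions over k can be compared by counting.

   Two facts on S are needed.  First, c S is contained in R for some c <> 0: the
   trace form bounds the denominators of the elements integral over Z, and S is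
   obtained from those by multiplying with elements of R.  Second, m S is
   invertible: for y in Frac R, the Horner tails of a primitive integral
   relation of y show that the fractional ideal generated by 1 and y is
   invertible, and this extends to finitely many generators.

   Write m S = (a_0, ..., a_{t-1}) and g = sum a_i X^i.  As m S is invertible,
   McCoy's argument shows that g h in (m S)[X] forces h in S[X].  For c S
   contained in I, multiplication by g thus embeds (I / c S)[X] into
   (m I / c m S)[X] and raises degrees by less than t.  Counting polynomials of
   degree < N and letting N grow gives |I / c S| <= |m I / c m S|, that is
   |I / m I| <= |c S / c m S| = |S / m S|.  The generic g replaces a reduction
   of m, which need not exist since k is finite. *)

Set Implicit Arguments. Unset Strict Implicit. Unset Printing Implicit Defensive.
Import GRing.Theory Num.Theory.
Local Open Scope ring_scope.

(** * Transversals of subgroups *)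

Lemma ex_max_nat (P : nat -> Prop) (b : nat) :
  P 0%N -> (forall n, P n -> (n <= b)%N) -> exists2 n, P n & ~ P n.+1.
Proof.
move=> P0 Pb; apply: contrapT => noP.
have PS n : P n by elim: n => // n Pn; apply: contrapT => nP; apply: noP; exists n.
by have := Pb _ (PS b.+1); rewrite ltnn.
Qed.

(** If E < M, then (M / E)^N would outgrow every constant, by Bernoulli's inequality. *)
Lemma leq_of_expn_leq (M E b t : nat) :
  (forall N, (M ^ (N + t) <= E ^ (N + t) * b)%N) -> (M <= E)%N.
Proof.
move=> MEb; rewrite leqNgt; apply/negP => ltEM.
have [E0|E_gt0] := posnP E.
  have := MEb 1%N; rewrite E0 add1n exp0n // mul0n leqn0 expn_eq0.
  by move: ltEM; rewrite E0 lt0n => /negPf->.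
(* Bernoulli's (1 + 1/E)^N >= 1 + N/E, cleared of denominators. *)
have bern N : (E ^ N * (E + N) <= E * E.+1 ^ N)%N.
  elim: N => [|N IHN]; first by rewrite !expn0; lia.
  rewrite !expnS; nia.
have := MEb (E * b)%N; set N := (E * b + t)%N.
have := bern N; have : (E.+1 ^ N <= M ^ N)%N by rewrite leq_exp2r // addn_gt0 muln_gt0 E_gt0; case: (b) (MEb 0%N); lia.
have : (0 < E ^ N)%N by rewrite expn_gt0 E_gt0.
rewrite {2}/N; set x := (E ^ N)%N; set y := (E.+1 ^ N)%N; set z := (M ^ N)%N.
by nia.
Qed.

Definition subgroup (V : zmodType) (A : V -> Prop) : Prop :=
  A 0 /\ forall x y, A x -> A y -> A (x - y).

(** Quotients A / B are never formed; finite families of representatives bound the index [A : B] or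
    compute it. *)
Definition separated (V : zmodType) (A B : V -> Prop) (T : finType) (s : T -> V) :=
  (forall t, A (s t)) /\ forall t u, B (s t - s u) -> t = u.

(** The [s t] need not lie in [A], so a covering family also covers every smaller set. *)
Definition covering (V : zmodType) (A B : V -> Prop) (T : finType) (s : T -> V) :=
  forall a, A a -> exists t, B (a - s t).

Definition transversal (V : zmodType) (A B : V -> Prop) (T : finType) (s : T -> V) :=
  separated A B s /\ covering A B s.

Section Subgroups.
Variable V : zmodType.
Implicit Types A B C : V -> Prop.

Lemma subgroupN A x : subgroup A -> A x -> A (- x).
Proof. by move=> [A0 AB] Ax; rewrite -sub0r; apply: AB. Qed.

Lemma subgroupD A x y : subgroup A -> A x -> A y -> A (x + y).
Proof. by move=> sA Ax /(subgroupN sA) Ay; rewrite -[y]opprK; apply: sA.2. Qed.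

Lemma subgroup_sum A (I : Type) {r : seq I} (P : pred I) (F : I -> V) :
  subgroup A -> (forall i, P i -> A (F i)) -> A (\sum_(i <- r | P i) F i).
Proof.
by move=> sA AF; apply: big_ind => //; [exact: sA.1|move=> x y; exact: subgroupD].
Qed.

Lemma separated_covering_leq A B (T U : finType) (s : T -> V) (u : U -> V) :
  subgroup B -> separated A B s -> covering A B u -> (#|T| <= #|U|)%N.
Proof.
move=> sB [sA sinj] cov.
have [f fP] := choice (fun t => cov _ (sA t)).
apply: (@leq_card _ _ f) => t t' eqf; apply: sinj.
rewrite -(subrKA (u (f t))) -(opprB (s t')); apply: (subgroupD sB (fP t)).
by rewrite eqf; apply: (subgroupN sB (fP _)).
Qed.

Lemma transversal_card A B (T U : finType) (s : T -> V) (u : U -> V) :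
  subgroup B -> transversal A B s -> transversal A B u -> #|T| = #|U|.
Proof.
move=> sB [ss cs] [su cu]; apply/eqP; rewrite eqn_leq.
by rewrite (separated_covering_leq sB ss cu) (separated_covering_leq sB su cs).
Qed.

Lemma covering_trans A B C (T U : finType) (s : T -> V) (u : U -> V) :
  covering A B s -> covering B C u ->
  covering A C (fun p : T * U => s p.1 + u p.2).
Proof.
move=> cs cu a /cs[t /cu[v Cv]]; exists (t, v) => /=.
by rewrite opprD addrA.
Qed.

Lemma transversal_trans A B C (T U : finType) (s : T -> V) (u : U -> V) :
    subgroup A -> subgroup B -> (forall x, B x -> A x) -> (forall x, C x -> B x) ->
  transversal A B s -> transversal B C u ->
  transversal A C (fun p : T * U => s p.1 + u p.2).
Proof.
move=> sA sB BA CB [[As sinj] cs] [[Bu uinj] cu]; split; last by apply: covering_trans cs cu.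
split=> [[t v]|[t v] [t' v']] /=; first by apply: (subgroupD sA) => //; apply: BA.
rewrite opprD addrACA => Cd.
have Bd := CB _ Cd.
have tt' : t = t'.
  apply: sinj; rewrite -[s t - _](addrK (u v - u v')); apply: sB.2 => //.
  exact: sB.2.
move: Cd; rewrite tt' subrr add0r => /uinj ->; by [].
Qed.

(** A separated family of maximal size is covering, since an uncovered element could be added to it;
    sizes are bounded by that of [u]. *)
Lemma ex_transversal A B (U : finType) (u : U -> V) :
    subgroup A -> subgroup B -> covering A B u ->
  exists (T : finType) (s : T -> V), transversal A B s /\ (0 < #|T|)%N.
Proof.
move=> sA sB cu.
pose P n := exists (T : finType) (s : T -> V), #|T| = n /\ separated A B s.
have [||n [T [s [Tn [As sinj]]]] nP] := @ex_max_nat P #|U|.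
- exists void, (fun v : void => match v with end); split; first by rewrite card_void.
  by split=> -[].
- by move=> n [T [s [<- sep]]]; exact: (separated_covering_leq sB sep cu).
have cov : covering A B s.
  move=> a Aa; apply: contrapT => noa; apply: nP.
  exists (option T), (fun o => oapp s a o); rewrite card_option Tn; split=> //.
  split=> [[t|] //=|[t|] [t'|] //=]; first by move/sinj->.
    by move=> Bta; case: noa; exists t; rewrite -opprB; apply: (subgroupN sB).
  by move=> Bat; case: noa; exists t'.
exists T, s; split; first by split.
by have [t _] := cov 0 sA.1; apply/card_gt0P; exists t.
Qed.

End Subgroups.

(** * Multiplication by a polynomial with invertible content *)

Section GenericMultiplication.
Variable F : fieldType.

(* McCoy's argument: [g] has invertible content, so it is a nonzerodivisor
   modulo [A]; the leading terms of [g] are peeled off one at a time. *)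
Lemma content_cancel (S A : F -> Prop) (g : {poly F}) (d : nat) (w : 'I_d -> F) :
    subgroup S -> subgroup A -> (forall x y, S x -> A y -> A (x * y)) ->
    (forall i x, S x -> A (g`_i * x)) -> (forall i x, A x -> S (w i * x)) ->
    (forall i j, S (w i * g`_j)) -> \sum_i w i * g`_i = 1 ->
  forall h : {poly F}, (forall k, A (g * h)`_k) -> forall k, S h`_k.
Proof.
move=> sS sA SA gSA wAS wgS wg1 h.
have [n le_hn] := ubnP (size h); elim: n => // n IHn in h le_hn *.
rewrite ltnS in le_hn => Agh.
(* This suffices because h_k is the sum of the w_i (g_i h_k). *)
suff Agih i k : A (g`_i * h`_k).
  move=> k; rewrite -[h`_k]mul1r -wg1 mulr_suml; apply: subgroup_sum => // i _.
  by rewrite -mulrA; apply: wAS.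
(* Downward induction on i, inside the induction on the size of h. *)
move: k; have [e le_gie] := ubnP (size g - i)%N.
elim: e => // e IHe in i le_gie *; rewrite ltnS in le_gie.
have [le_gi|lt_ig] := leqP (size g) i.
  by move=> k; rewrite nth_default // mul0r; apply: sA.1.
have Ahigh j k : (i < j)%N -> A (g`_j * h`_k) by move=> ltij; apply: IHe; lia.
case: n => [|n] in IHn le_hn.
  by move=> k; rewrite [h`_k]nth_default ?mulr0; [apply: sA.1|apply: leq_trans le_hn _].
(* In coefficient i + n of g h, the terms g_j h_(i+n-j) with j > i lie in A by induction, and those
   with j < i vanish. *)
have Atop : A (g`_i * h`_n).
  have le_i : (i < (i + n).+1)%N by lia.
  have := Agh (i + n)%N; rewrite coefM (bigD1 (Ordinal le_i)) //= addKn.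
  set T := \sum_(j < _ | _) _ => AT.
  rewrite -[_ * _](addrK T); apply: sA.2 => //; apply: subgroup_sum => // j neji.
  have [ltij|leji] := ltnP i j; first exact: Ahigh.
  rewrite [h`_(_)]nth_default ?mulr0; first exact: sA.1.
  by move: neji; rewrite -val_eqE /= => neji; apply: leq_trans le_hn _; lia.
(* Removing the term of degree n from w_l g_i h leaves a polynomial of smaller size whose product
   with g still has coefficients in A. *)
have Swgh l k : S (w l * (g`_i * h`_k)).
  pose a := w l * g`_i.
  have [->|neqkn] := eqVneq k n; first exact: wAS.
  pose h' := a *: h - (a * h`_n) *: 'X^n.
  have hE j : h'`_j = if j == n then 0 else a * h`_j.
    rewrite coefB !coefZ coefXn; case: eqP => [->|_]; first by rewrite mulr1 subrr.
    by rewrite mulr0 subr0.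
  have -> : w l * (g`_i * h`_k) = h'`_k by rewrite hE (negPf neqkn) mulrA.
  apply: IHn => [|j].
    rewrite ltnS; apply/leq_sizeP => j le_nj; rewrite hE; case: eqP => // neqj.
    by rewrite nth_default ?mulr0 //; apply: leq_trans le_hn _; lia.
  rewrite mulrBr -!scalerAr coefB !coefZ; apply: sA.2; first by apply: SA; [apply: wgS|apply: Agh].
  rewrite coefMXn; case: ifP => _; first by rewrite mulr0; apply: sA.1.
  by rewrite mulrC; apply: gSA; rewrite -mulrA; apply: wAS.
move=> k; rewrite -[X in A X]mul1r -wg1 mulr_suml; apply: subgroup_sum => // l _.
by rewrite -mulrA mulrCA; apply: gSA.
Qed.

(** Distinct polynomials h of degree < N with coefficients taken from [s] stay distinct modulo N2
    after multiplication by g, and g h has at most N + size g coefficients. *)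
Lemma card_expn_leq (I J N1 N2 : F -> Prop) (g : {poly F}) (T U : finType)
    (s : T -> F) (u : U -> F) :
    subgroup I -> subgroup J -> subgroup N2 ->
    (forall i x, I x -> J (g`_i * x)) ->
    (forall h : {poly F}, (forall k, N2 (g * h)`_k) -> forall k, N1 h`_k) ->
    separated I N1 s -> covering J N2 u ->
  forall N, (#|T| ^ N <= #|U| ^ (N + size g))%N.
Proof.
move=> sI sJ sN2 gIJ gN [sI' sinj] cov N.
pose hp (f : {ffun 'I_N -> T}) := \poly_(j < N) oapp (s \o f) 0 (insub j).
have hpE f (j : 'I_N) : (hp f)`_j = s (f j) by rewrite coef_poly ltn_ord valK.
have Ihp f j : I (hp f)`_j.
  rewrite coef_poly; case: ifP => _; last exact: sI.1.
  by case: insubP => [i _ _|_] /=; [apply: sI'|apply: sI.1].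
have Jghp f k : J (g * hp f)`_k.
  by rewrite coefM; apply: subgroup_sum => // i _; apply: gIJ.
have [cl clP] := choice (fun fk : {ffun 'I_N -> T} * nat => cov _ (Jghp fk.1 fk.2)).
pose phi f := [ffun k : 'I_(N + size g) => cl (f, val k)].
suff inj : injective phi by move: (leq_card phi inj); rewrite !card_ffun !card_ord.
move=> f f' eqff'; apply/ffunP => j; apply: sinj; rewrite -!hpE -coefB.
apply: gN => k; rewrite mulrBr coefB.
have [ltk|lek] := ltnP k (N + size g).
  have := congr1 (fun p : {ffun _} => p (Ordinal ltk)) eqff'.
  rewrite !ffunE /= => eqcl.
  rewrite -(subrKA (u (cl (f, k)))) -(opprB _ (u _)).
  apply: (subgroupD sN2 (clP (f, k))); rewrite eqcl.
  exact: subgroupN (clP (f', k)).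
have sz f0 : (size (g * hp f0)%R <= k)%N.
  apply: leq_trans (size_polyMleq _ _) _; have := size_poly N (fun j => oapp (s \o f0) 0 (insub j)).
  rewrite -/(hp f0); lia.
by rewrite !nth_default // subrr; apply: sN2.1.
Qed.

End GenericMultiplication.

(** * Integral elements *)

Section SubringType.
Variables (L : fieldExtType rat) (R : L -> Prop).

(** The proof is an argument so that the ring structure can be attached to this predicate. *)
Definition subring_pred of is_subring R : {pred L} := fun x => `[< R x >].

Variable subR : is_subring R.

Lemma subring_pred_closed : subring_closed (subring_pred subR).
Proof.
case: (subR) => R0 R1 RB RD RM; split; first exact/asboolP.
  by move=> x y /asboolP Rx /asboolP Ry; apply/asboolP/RB.
by move=> x y /asboolP Rx /asboolP Ry; apply/asboolP/RM.
Qed.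

HB.instance Definition _ :=
  GRing.isSubringClosed.Build L (subring_pred subR) subring_pred_closed.

Definition subring_type := {x : L | x \in subring_pred subR}.
HB.instance Definition _ := SubChoice.on subring_type.
HB.instance Definition _ := [SubChoice_isSubComNzRing of subring_type by <:].

Definition subring_val : {rmorphism subring_type -> L} := val.

(** Gives access to the closure of [integralOver] under ring operations. *)
Lemma integral_overP x : integral_over R x <-> integralOver subring_val x.
Proof.
split=> [[p [mon_p Rp px0]]|[p mon_p px0]].
  have Rp' i : p`_i \in subring_pred subR by apply/asboolP/Rp.
  pose q : {poly subring_type} := \poly_(i < size p) (Sub p`_i (Rp' i)).
  have qE : map_poly subring_val q = p.
    apply/polyP => i; rewrite coef_map coef_poly.
    have [lti|lei] := ltnP i (size p); first exact: SubK.
    by rewrite raddf0 nth_default.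
  exists q; last by rewrite qE.
  have val_inj' : injective subring_val := val_inj.
  apply/eqP/val_inj'; rewrite rmorph1 -(lead_coef_map_inj val_inj') ?raddf0 //.
  by rewrite qE (eqP mon_p).
exists (map_poly subring_val p); split=> //.
  by apply: monic_map.
by move=> i; rewrite coef_map; apply/asboolP/(valP p`_i).
Qed.

End SubringType.

Section IntegralHorner.
Variables (B : comNzRingType) (K : fieldType) (f : {rmorphism B -> K}).

(** With c the leading coefficient and d the degree, multiplying p(y) = 0 by c^(d-1) gives a monic
    equation for c y with integral coefficients. *)
Lemma integral_lead_coef (p : {poly K}) y :
  (forall i, integralOver f p`_i) -> root p y -> integralOver f (lead_coef p * y).
Proof.
move=> intp py0; set c := lead_coef p.
have [p0|p_neq0] := eqVneq p 0.
  by rewrite /c p0 lead_coef0 mul0r; apply: integral0.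
have [n szp] : exists n, size p = n.+1.
  by exists (size p).-1; rewrite prednK // size_poly_gt0.
have cE : c = p`_n by rewrite /c lead_coefE szp.
case: n => [|n] in szp cE.
  by move: py0; rewrite (size1_polyC (eq_leq szp)) rootC -cE => /eqP->;
     rewrite mul0r; apply: integral0.
pose r := \poly_(i < n.+1) (p`_i * c ^+ (n - i)).
have szr : (size r < size ('X^(n.+1) : {poly K})%R)%N by rewrite size_polyXn ltnS size_poly.
apply: (@integral_root_monic _ _ f _ ('X^(n.+1) + r)).
- by rewrite monicE lead_coefDl // lead_coefXn.
- apply/eqP; transitivity (c ^+ n * p.[y]); last by rewrite (eqP py0) mulr0.
  rewrite hornerD hornerXn horner_poly horner_coef szp [in RHS]big_ord_recr /= -cE.
  rewrite mulrDr addrC.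
  congr (_ + _); last by rewrite exprMn exprSr; ring.
  rewrite mulr_sumr; apply: eq_bigr => i _.
  have le_in : (i <= n)%N by rewrite -ltnS.
  have -> : c ^+ n = c ^+ (n - i) * c ^+ i by rewrite -exprD subnK.
  by rewrite exprMn; ring.
apply/integral_poly => i; rewrite coefD; apply: integral_add.
  by rewrite coefXn; apply: integral_nat.
rewrite coef_poly; case: ifP => _; last exact: integral0.
apply: integral_mul; first exact: intp.
rewrite cE; elim: (n - i)%N => [|k IHk]; first by rewrite expr0; apply: integral1.
by rewrite exprS; apply: integral_mul.
Qed.

Lemma horner_drop_polyS (p : {poly K}) y k :
  (drop_poly k p).[y] = p`_k + y * (drop_poly k.+1 p).[y].
Proof.
have -> : drop_poly k p = (p`_k)%:P + drop_poly k.+1 p * 'X.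
  apply/polyP => i; rewrite coefD coefC coefMX !coef_drop_poly.
  by case: i => [|i]; rewrite ?addr0 ?add0r ?addn0 // addSnnS.
by rewrite hornerD hornerC hornerMX mulrC.
Qed.

Lemma integral_horner_drop (p : {poly K}) y k :
  (forall i, integralOver f p`_i) -> root p y -> integralOver f (drop_poly k p).[y].
Proof.
move=> intp py0; have [d le_kd] := ubnP (size p - k)%N.
elim: d => // d IHd in k le_kd *; rewrite ltnS in le_kd.
have [le_pk|lt_kp] := leqP (size p) k.
  by rewrite drop_poly_eq0 // horner0; apply: integral0.
have int_next : integralOver f (drop_poly k.+1 p).[y] by apply: IHd; lia.
rewrite horner_drop_polyS mulrC; apply: integral_add => //; set b := (drop_poly _ _).[y].
have [->|b_neq0] := eqVneq b 0; first by rewrite mul0r; apply: integral0.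
(* The tail value b is the leading coefficient of this polynomial, which vanishes at y and has
   integral coefficients; so b y is integral. *)
pose q := b *: 'X^(k.+1) + take_poly k.+1 p.
have szq : (size (take_poly k.+1 p) < size (b *: 'X^(k.+1))%R)%N.
  by rewrite size_scale // size_polyXn ltnS size_take_poly.
have -> : b = lead_coef q by rewrite lead_coefDl // lead_coefZ lead_coefXn mulr1.
apply: integral_lead_coef => [i|].
  rewrite coefD coefZ coefXn coef_take_poly; apply: integral_add.
    by apply: integral_mul => //; apply: integral_nat.
  by case: ifP => _; [apply: intp|apply: integral0].
rewrite /root hornerD hornerZ hornerXn -hornerXn -hornerM addrC -hornerD.
by rewrite poly_take_drop.
Qed.

End IntegralHorner.

(** Clear denominators in the minimal polynomial and divide by the content; primitivity later
    provides a coefficient prime to q. *)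
Lemma ex_primitive_relation (L : fieldExtType rat) (x : L) :
  exists p : {poly int}, [/\ p != 0, zcontents p = 1 & root (map_poly intr p) x].
Proof.
have /polyOver1P[q qE] := minPolyOver 1 x.
have q_neq0 : q != 0.
  by apply: contraTneq (monic_minPoly 1 x) => q0; rewrite qE q0 rmorph0 monicE lead_coef0 eq_sym oner_eq0.
have [r [a a_neq0 qEr]] := rat_poly_scale q.
have r_neq0 : r != 0.
  by apply: contraNneq q_neq0 => r0; rewrite qEr r0 rmorph0 scaler0.
exists (zprimitive r); split; rewrite ?zprimitive_eq0 ?zcontents_primitive ?r_neq0 //.
have: root (map_poly (in_alg L) q) x by rewrite -qE root_minPoly.
have -> : map_poly (in_alg L) q = (in_alg L (a%:~R^-1 * (zcontents r)%:~R)) *: map_poly intr (zprimitive r).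
  apply/polyP => i; rewrite qEr coef_map /= !coefZ !coef_map /= {1}(zpolyEprim r) coefZ.
  by rewrite intrM mulrA -[LHS]/(in_alg L _) rmorphM /= -[(_%:~R)%:A]/(in_alg L _) rmorph_int.
rewrite rootZ // fmorph_eq0 mulf_neq0 ?invr_eq0 ?intr_eq0 //.
by rewrite zcontents_eq0.
Qed.

Lemma zprimitive_coef (p : {poly int}) (q : nat) :
  prime q -> zcontents p = 1 -> exists i, ~~ (q%:Z %| p`_i)%Z.
Proof.
move=> q_pr cp1; apply: contrapT => nodiv.
have : (q%:Z %| zcontents p)%Z.
  rewrite dvdz_contents; apply/polyOverP => i; apply: contrapT => /negP ndvd.
  by apply: nodiv; exists i.
by rewrite cp1 dvdz1 /= => /eqP q1; rewrite q1 in q_pr.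
Qed.

(** * Subrings of a number field and their fraction fields *)

Section Subrings.
Variables (L : fieldExtType rat) (R : L -> Prop).
Hypothesis subR : is_subring R.

Lemma subring_subgroup : subgroup R.
Proof. by case: subR. Qed.

Lemma subring_int (z : int) : R z%:~R.
Proof.
case: (subR) => R0 R1 RB RD RM.
have RN n : R n%:R by elim: n => // n IHn; rewrite -natr1; apply: RD.
case: z => n; first by rewrite -pmulrn; apply: RN.
by rewrite NegzE mulrNz -pmulrn; apply: (subgroupN subring_subgroup); apply: RN.
Qed.

Lemma subring_nat n : R n%:R.
Proof. by rewrite pmulrn; apply: subring_int. Qed.

Lemma subring_exp x n : R x -> R (x ^+ n).
Proof.
case: (subR) => R0 R1 RB RD RM Rx.
by elim: n => [|n IHn]; rewrite ?expr0 // exprS; apply: RM.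
Qed.

Lemma subring_horner (p : {poly L}) x : (forall i, R p`_i) -> R x -> R p.[x].
Proof.
case: (subR) => R0 R1 RB RD RM Rp Rx.
rewrite horner_coef; apply: (subgroup_sum subring_subgroup) => i _.
by apply: RM => //; apply: subring_exp.
Qed.

Lemma subring_integral_int x : integralOver (intr : int -> L) x -> integral_over R x.
Proof.
case=> p mon_p px0; exists (map_poly intr p); split=> //; first exact: monic_map.
by move=> i; rewrite coef_map; apply: subring_int.
Qed.

(** The lowest nonzero coefficient of an integral relation is, up to sign, x times an integral
    polynomial in x. *)
Lemma ex_nat_multiple x : R x -> x != 0 ->
  exists2 y, R y & exists2 N : nat, N != 0 & x * y = N%:R.
Proof.
case: (subR) => R0 R1 RB RD RM Rx x_neq0.
have [p [p_neq0 _ px0]] := ex_primitive_relation x.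
set P := map_poly intr p in px0.
have exk : exists k, p`_k != 0.
  by exists (size p).-1; rewrite -lead_coefE lead_coef_eq0.
case: (ex_minnP exk) => k pk_neq0 min_k.
have take0 : take_poly k P = 0.
  apply/polyP => i; rewrite coef_take_poly coef0; case: ltnP => // ltik.
  rewrite coef_map /=; have [->|/min_k] := eqVneq p`_i 0; first by rewrite mulr0z.
  by rewrite leqNgt ltik.
have dropk0 : (drop_poly k P).[x] = 0.
  apply/eqP; move: px0; rewrite -{1}(poly_take_drop k P) take0 add0r.
  by rewrite /root hornerM hornerXn mulf_eq0 expf_eq0 (negPf x_neq0) andbF orbF.
pose y := (drop_poly k.+1 P).[x].
have Ry : R y.
  apply: subring_horner => // i; rewrite coef_drop_poly coef_map /=; exact: subring_int.
have xyE : x * y = - (p`_k)%:~R.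
  by apply/eqP; rewrite -addr_eq0 addrC -dropk0 horner_drop_polyS coef_map.
case: (p`_k) pk_neq0 xyE => [n|n] n_neq0 xyE.
  exists (- y); first exact: (subgroupN subring_subgroup).
  by exists n; rewrite ?mulrN ?xyE ?opprK.
by exists y => //; exists n.+1; rewrite ?xyE ?NegzE ?mulrNz ?opprK.
Qed.

Lemma sub_frac x : R x -> frac R x.
Proof. by case: subR => R0 R1 RB RD RM Rx; exists x, 1; rewrite divr1 oner_eq0. Qed.

Lemma frac_inv x : frac R x -> frac R x^-1.
Proof.
case: subR => R0 R1 RB RD RM [a [b [Ra Rb b_neq0 ->]]].
have [->|a_neq0] := eqVneq a 0; first by rewrite mul0r invr0; apply: sub_frac.
by exists b, a; rewrite invf_div.
Qed.

Lemma frac_mul x y : frac R x -> frac R y -> frac R (x * y).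
Proof.
case: subR => R0 R1 RB RD RM [a [b [Ra Rb b_neq0 ->]]] [c [d [Rc Rd d_neq0 ->]]].
by exists (a * c), (b * d); rewrite mulf_neq0 // mulf_div; split=> //; apply: RM.
Qed.

Lemma frac_sub x y : frac R x -> frac R y -> frac R (x - y).
Proof.
case: subR => R0 R1 RB RD RM [a [b [Ra Rb b_neq0 ->]]] [c [d [Rc Rd d_neq0 ->]]].
exists (a * d - c * b), (b * d); rewrite mulf_neq0 //; split=> //.
- by apply: RB; apply: RM.
- exact: RM.
by field; rewrite b_neq0 d_neq0.
Qed.

Lemma frac_subring : is_subring (frac R).
Proof.
case: (subR) => R0 R1 RB RD RM; have FN y : frac R y -> frac R (- y).
  by move=> Fy; rewrite -sub0r; apply: frac_sub => //; apply: sub_frac.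
split; try exact: sub_frac; first exact: frac_sub; last exact: frac_mul.
by move=> x y Fx /FN Fy; rewrite -[y]opprK; apply: frac_sub.
Qed.

Lemma frac_nat_multiple x : frac R x -> exists2 N : nat, N != 0 & R (N%:R * x).
Proof.
case: (subR) => R0 R1 RB RD RM [a [b [Ra Rb b_neq0 ->]]].
have [c Rc [N N_neq0 bcN]] := ex_nat_multiple Rb b_neq0; exists N => //.
by rewrite -bcN mulrCA mulrAC divff // mul1r; apply: RM.
Qed.

(** U is the rational span of R, found as a subspace of maximal dimension among those whose elements
    have nonzero integer multiples in R. *)
Lemma ex_nat_multiple_space :
  exists U : {vspace L}, [/\ forall x, R x -> x \in U &
    forall x, x \in U -> exists2 N : nat, N != 0 & R (N%:R * x)].
Proof.
case: (subR) => R0 R1 RB RD RM.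
pose good (U : {vspace L}) := forall x, x \in U -> exists2 N : nat, N != 0 & R (N%:R * x).
pose P n := exists2 U, good U & (n <= \dim U)%N.
have [||n [U goodU ltn] nP] := @ex_max_nat P (\dim {:L}).
- by exists 0%VS => // x; rewrite memv0 => /eqP->; exists 1%N; rewrite ?mulr0.
- by move=> n [U _ /leq_trans]; apply; apply: dimvS; apply: subvf.
exists U; split=> // x Rx; apply: contrapT => /negP xU; apply: nP.
exists (U + <[x]>)%VS; last first.
  apply: leq_ltn_trans ltn _; rewrite ltn_neqAle dimvS ?addvSl // andbT.
  apply: contra xU => /eqP eqdim; have /eqP-> : U == (U + <[x]>)%VS.
    by rewrite eqEdim addvSl eqdim leqnn.
  by rewrite memvE addvSr.
move=> _ /memv_addP[y /goodU[N N_neq0 RNy] [_ /vlineP[q ->] ->]].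
exists (N * `|denq q|)%N; first by rewrite muln_eq0 negb_or N_neq0 absz_eq0 denq_neq0.
rewrite mulrDr; apply: RD.
  by rewrite natrM mulrAC; apply: RM => //; apply: subring_nat.
rewrite natrM -mulrA; apply: (RM); first exact: subring_nat.
have -> : `|denq q|%:R * (q *: x) = (numq q)%:~R * x.
  have qE : q * (denq q)%:~R = (numq q)%:~R by rewrite numqE.
  rewrite pmulrn gez0_abs ?denq_ge0 // -mulr_algl mulrA; congr (_ * _).
  rewrite -[_%:A]/(in_alg L q) -!(rmorph_int (in_alg L)) -rmorphM /=.
  by rewrite mulrC qE.
by apply: RM => //; apply: subring_int.
Qed.
End Subrings.

(** * The trace form *)

Section RegularTrace.
Variable L : fieldExtType rat.
Let d := \dim {:L}.
Let e := vbasis {:L}.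

(** The regular representation on coordinate rows; its trace is the trace of L over Q. *)
Definition regular_mx (y : L) : 'M[rat]_d :=
  \matrix_(i, j) coord e j (e`_i * y).

Lemma regular_mx_is_linear : linear regular_mx.
Proof.
move=> a x y; apply/matrixP => i j; rewrite !mxE mulrDr -scalerAr.
by rewrite linearD linearZ.
Qed.

HB.instance Definition _ := GRing.isLinear.Build rat L 'M[rat]_d *:%R regular_mx
  regular_mx_is_linear.

Lemma regular_mxM x y : regular_mx (x * y) = regular_mx x *m regular_mx y.
Proof.
apply/matrixP => i j; rewrite !mxE mulrA.
rewrite {1}(coord_vbasis (memvf (e`_i * x))) mulr_suml linear_sum /=.
by apply: eq_bigr => k _; rewrite !mxE -scalerAl linearZ.
Qed.

Lemma regular_mx1 : regular_mx 1 = 1%:M.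
Proof.
apply/matrixP => i j; rewrite !mxE mulr1 coord_free ?(basis_free (vbasisP _)) //.
Qed.

Lemma dim_fullv_gt0 : (0 < d)%N.
Proof. by have := dimvS (subvf (1%VS : {vspace L})); rewrite dimv1. Qed.

(** For an eigenvector v of the matrix M of y, p(z) v = v p(M), and p(M) represents p(y) = 0. *)
Lemma root_eigenvalue_regular_mx (p : {poly int}) (y : L) (z : algC) :
    p \is monic -> root (map_poly intr p) y ->
    eigenvalue (map_mx ratr (regular_mx y)) z ->
  root (map_poly intr p) z.
Proof.
move=> mon_p py0 /eigenvalueP[v vM v_neq0].
have vMX k : v *m map_mx ratr (regular_mx (y ^+ k)) = z ^+ k *: v.
  elim: k => [|k IHk]; first by rewrite !expr0 regular_mx1 map_mx1 mulmx1 scale1r.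
  by rewrite exprSr regular_mxM map_mxM mulmxA IHk -scalemxAl vM scalerA -exprSr.
have szp (A : nzRingType) : size (map_poly (intr : int -> A) p) = size p.
  by rewrite size_map_poly_id0 // (monicP mon_p) oner_eq0.
have : (map_poly intr p).[z] *: v = v *m map_mx ratr (regular_mx (map_poly intr p).[y]).
  rewrite !horner_coef !szp linear_sum raddf_sum mulmx_sumr scaler_suml.
  apply: eq_bigr => k _; rewrite !coef_map /= !mulrzl -scalerMzl -vMX.
  by rewrite -(raddfMz (mulmx v)) /= -raddfMz -raddfMz.
rewrite (eqP py0) linear0 map_mx0 mulmx0 => /eqP.
by rewrite scaler_eq0 (negPf v_neq0) orbF.
Qed.

(** The trace is the sum of the eigenvalues in [algC], which are algebraic integers, and a rational
    algebraic integer is an integer. *)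
Lemma trace_regular_mx_int (y : L) :
  integralOver (intr : int -> L) y -> \tr (regular_mx y) \is a Num.int.
Proof.
case=> p mon_p py0; set M := regular_mx y.
pose Mc := map_mx ratr M : 'M[algC]_d.
suff : \tr Mc \in Aint.
  rewrite trace_map_mx => /(Cint_rat_Aint (Crat_rat _)).
  by rewrite Cint_rat.
have [r] := closed_field_poly_normal (char_poly Mc).
rewrite (monicP (char_poly_monic Mc)) scale1r => charE.
have szr : size r = d.
  by have := size_char_poly Mc; rewrite charE size_prod_XsubC => -[].
have : - \tr Mc = - \sum_(z <- r) z.
  rewrite -char_poly_trace ?dim_fullv_gt0 // charE -{1}szr coefPn_prod_XsubC //.
  by rewrite szr -lt0n dim_fullv_gt0.
move/oppr_inj->; rewrite big_seq; apply: rpred_sum => z rz.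
have eigz : eigenvalue Mc z by rewrite eigenvalue_root_char charE root_prod_XsubC.
apply: (root_monic_Aint (root_eigenvalue_regular_mx mon_p py0 eigz)).
  exact: monic_map.
by apply/polyOverP => k; rewrite coef_map /= intr_int.
Qed.

Lemma intrL_eq0 (z : int) : (z%:~R == 0 :> L) = (z == 0).
Proof. by rewrite -(rmorph_int (in_alg L)) fmorph_eq0 intr_eq0. Qed.

Lemma ex_integral_multiple (x : L) :
  exists z : int, z != 0 /\ integralOver (intr : int -> L) (z%:~R * x).
Proof.
have [p [p_neq0 _ px0]] := ex_primitive_relation x.
exists (lead_coef p); split; first by rewrite lead_coef_eq0.
have <- : lead_coef (map_poly (intr : int -> L) p) = (lead_coef p)%:~R.
  rewrite -lead_coef_map_inj // => a b /eqP; rewrite -subr_eq0 -intrB intrL_eq0.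
  by rewrite subr_eq0 => /eqP.
apply: integral_lead_coef px0 => i; rewrite coef_map; exact: integral_id.
Qed.

(* The Gram matrix of the trace form in a basis of integral elements is an
   invertible integral matrix, so its determinant is a common denominator. *)
Lemma ex_integral_denominator :
  exists2 c : int, c != 0 & exists n (E : 'I_n -> L),
    forall y, integralOver (intr : int -> L) y ->
    exists z : 'I_n -> int, c%:~R * y = \sum_(i < n) (z i)%:~R * E i.
Proof.
pose tr y := \tr (regular_mx y).
have trZ a y : tr (a *: y) = a * tr y by rewrite /tr linearZ /= mxtraceZ.
have tr_sum n (F : 'I_n -> L) : tr (\sum_(i < n) F i) = \sum_(i < n) tr (F i).
  by rewrite /tr linear_sum raddf_sum.
have [D DP] := choice (fun i : 'I_d => ex_integral_multiple e`_i).
pose E i := (D i)%:~R * e`_i.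
have Espan y : exists q : 'rV[rat]_d, y = \sum_(i < d) q 0 i *: E i.
  exists (\row_i (coord e i y / (D i)%:~R)).
  rewrite {1}(coord_vbasis (memvf y)); apply: eq_bigr => i _; rewrite mxE.
  rewrite /E -(rmorph_int (in_alg L)) mulr_algl scalerA divfK // intr_eq0.
  by case: (DP i).
have Efree (q : 'rV[rat]_d) : \sum_(i < d) q 0 i *: E i = 0 -> q = 0.
  move=> q0; apply/rowP => i; rewrite mxE.
  have := congr1 (coord e i) q0; rewrite linear0.
  have -> : \sum_(i < d) q 0 i *: E i = \sum_(i < d) (q 0 i * (D i)%:~R) *: e`_i.
    by apply: eq_bigr => j _; rewrite /E -(rmorph_int (in_alg L)) mulr_algl scalerA.
  rewrite coord_sum_free ?(basis_free (vbasisP _)) // => /eqP.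
  by rewrite mulf_eq0 intr_eq0; case: (DP i) => /negPf-> _; rewrite orbF => /eqP.
pose G : 'M[rat]_d := \matrix_(i, j) tr (E i * E j).
have GM (q : 'rV[rat]_d) j : (q *m G) 0 j = tr ((\sum_(i < d) q 0 i *: E i) * E j).
  rewrite !mxE mulr_suml tr_sum; apply: eq_bigr => i _.
  by rewrite mxE -scalerAl trZ.
(* Nondegeneracy: a nonzero x orthogonal to L would give 0 = tr (x x^-1) = tr 1 = d. *)
have detG : \det G != 0.
  apply/negP => /det0P[q q_neq0 qG].
  set x := \sum_(i < d) q 0 i *: E i.
  have trx y : tr (x * y) = 0.
    have [q' ->] := Espan y; rewrite mulr_sumr tr_sum big1 // => j _.
    by rewrite -scalerAr trZ -GM qG mxE mulr0.
  have [x0|x_neq0] := eqVneq x 0; first by rewrite (Efree _ x0) eqxx in q_neq0.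
  have := trx x^-1; rewrite divff // /tr regular_mx1 mxtrace1 => /eqP.
  by rewrite pnatr_eq0 -leqn0 leqNgt dim_fullv_gt0.
have Eint i : integralOver (intr : int -> L) (E i) by case: (DP i).
have Gint i j : G i j \is a Num.int.
  by rewrite mxE; apply: trace_regular_mx_int; apply: (@integral_mul _ _ intr).
have det_int n (A : 'M[rat]_n) : (forall i j, A i j \is a Num.int) -> \det A \is a Num.int.
  move=> intA; apply: rpred_sum => s _; apply: rpredM; last exact: rpred_prod.
  by apply: rpredX; rewrite rpredN rpred1.
have /intrP[c cE] := det_int _ _ Gint.
exists c; first by rewrite -(intr_eq0 rat) -cE.
exists d, E => y inty; have [q qE] := Espan y.
pose t := q *m G.
have tint j : t 0 j \is a Num.int.
  by rewrite GM -qE; apply: trace_regular_mx_int; apply: (@integral_mul _ _ intr).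
(* Cramer's rule: (det G) q = t adj G, and both factors on the right are integral. *)
have cq i : exists z : int, (\det G * q 0 i) = z%:~R.
  apply/intrP; have -> : \det G * q 0 i = (t *m \adj G) 0 i.
    by rewrite /t -mulmxA mul_mx_adj mul_mx_scalar mxE.
  rewrite mxE; apply: rpred_sum => j _; apply: rpredM => //.
  rewrite mxE; apply: rpredM; first by apply: rpredX; rewrite rpredN rpred1.
  have minor_int : \det (row' i (col' j G)) \is a Num.int.
    by apply: det_int => k l; rewrite [row' _ _ _ _]mxE [col' _ _ _ _]mxE.
  exact: minor_int.
have [z zP] := choice cq; exists z.
rewrite qE mulr_sumr; apply: eq_bigr => i _.
rewrite -!(rmorph_int (in_alg L)) !mulr_algl scalerA -cE zP //.
Qed.

End RegularTrace.

(** * Local subrings *)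

Section LocalRing.
Variables (L : fieldExtType rat) (R m : L -> Prop).
Hypotheses (subR : is_subring R) (locR : is_local R) (maxm : maximal_ideal R m).

Lemma ideal_subgroup (I : L -> Prop) : ideal R I -> subgroup I.
Proof.
case: (subR) => R0 R1 RB RD RM [_ I0 ID IM]; split=> // x y Ix Iy.
by apply: ID => //; rewrite -mulN1r; apply: IM => //; rewrite -sub0r; apply: RB.
Qed.

Lemma maximal_sub x : m x -> R x.
Proof. by case: maxm => -[mR _ _ _] _ _; apply: mR. Qed.

Lemma maximal_subgroup : subgroup m.
Proof. by case: maxm => im _ _; apply: ideal_subgroup. Qed.

Lemma maximalMl r x : R r -> m x -> m (r * x).
Proof. by case: maxm => -[_ _ _ mM] _ _; apply: mM. Qed.

(** If x were not a unit, Zorn's lemma would give a maximal ideal containing x, and by locality this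
    ideal is m. *)
Lemma local_unit x : R x -> ~ m x -> exists2 y, R y & x * y = 1.
Proof.
case: (subR) => R0 R1 RB RD RM Rx nmx; apply: contrapT => nunit; apply: nmx.
pose proper (X : set L) := [/\ ideal R X, ~ X 1 & X x].
pose P (X : set L) := (forall y, ~ X y) \/ proper X.
have [F FP totF|A [PA maxA]] := @Zorn_bigcup L P.
  have [[X FX pX]|noX] := pselect (exists2 X, F X & proper X); last first.
    left=> y [X FX Xy]; case: (FP _ FX) => [/(_ y)//|pX].
    by apply: noX; exists X.
  right; have FP' Y y : F Y -> Y y -> proper Y.
    by move=> FY Yy; case: (FP _ FY) => // /(_ y).
  split; last by exists X => //; case: pX.
    split.
    - by move=> y [Y FY Yy]; have [[YR _ _ _] _ _] := FP' _ _ FY Yy; apply: YR.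
    - by exists X => //; case: pX => -[].
    - move=> y z [Y FY Yy] [Z FZ Zz].
      have [[_ _ YD _] _ _] := FP' _ _ FY Yy; have [[_ _ ZD _] _ _] := FP' _ _ FZ Zz.
      case: (totF _ _ FY FZ) => [YZ|ZY].
        by exists Z => //; apply: ZD => //; apply: YZ.
      by exists Y => //; apply: YD => //; apply: ZY.
    - move=> r y Rr [Y FY Yy]; exists Y => //.
      by have [[_ _ _ YM] _ _] := FP' _ _ FY Yy; apply: YM.
  by move=> [Y FY Y1]; have [_] := FP' _ _ FY Y1.
have proper_above B : proper B -> (forall y, A y -> B y) -> forall y, B y -> A y.
  move=> pB AB; apply: contrapT => nBA; apply: (maxA B); last by right.
  by split=> // BA; apply: nBA.
have [idA A1 Ax] : proper A.
  case: PA => // A0; exfalso; pose B : set L := fun z => exists2 r, R r & z = r * x.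
  have Bx : B x by exists 1; rewrite ?mul1r.
  apply: (A0 x); apply: (proper_above B) => // [|y /A0//]; split=> //.
    split=> [_ [r Rr ->]||_ _ [r Rr ->] [s Rs ->]|r _ Rr [s Rs ->]]; first exact: RM.
    - by exists 0; rewrite ?mul0r.
    - by exists (r + s); rewrite ?mulrDl //; apply: RD.
    - by exists (r * s); rewrite ?mulrA //; apply: RM.
  by move=> [r Rr /esym]; rewrite mulrC => xr1; apply: nunit; exists r.
have maxA' : maximal_ideal R A.
  split=> // J idJ AJ; have [J1|nJ1] := pselect (J 1); [by right|left].
  move=> y; split; last exact: AJ.
  by apply: (proper_above J) => //; split=> //; apply: AJ.
have [m0 [_ m0uniq]] := locR.
by apply/(m0uniq _ maxm)/(m0uniq _ maxA').
Qed.

Lemma maximal_prime x y : R x -> R y -> m (x * y) -> m x \/ m y.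
Proof.
move=> Rx Ry mxy; have [mx|nmx] := pselect (m x); [by left|right].
have [z Rz xz1] := local_unit Rx nmx.
by rewrite -[y]mul1r -xz1 mulrAC mulrC; apply: maximalMl.
Qed.

(** The ideal m contains a nonzero natural number and, being prime, one of its prime factors. *)
Lemma ex_residue_char x : m x -> x != 0 -> exists2 p, prime p & m p%:R.
Proof.
move=> mx x_neq0; have [y Ry [N N_neq0 xyN]] := ex_nat_multiple subR (maximal_sub mx) x_neq0.
have mN : m N%:R by rewrite -xyN mulrC; apply: maximalMl.
have [n le_Nn] := ubnP N; elim: n => // n IHn in N le_Nn N_neq0 mN {xyN} *.
have [N1|neqN1] := eqVneq N 1%N; first by case: maxm; rewrite N1 in mN.
have [p_pr|] := boolP (prime N); first by exists N.
have N_gt1 : (1 < N)%N by rewrite ltn_neqAle eq_sym neqN1 lt0n.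
move=> np; have pr := pdiv_prime N_gt1.
have := divnK (pdiv_dvd N); set q := (N %/ _)%N => NE.
move: mN; rewrite -NE natrM => /maximal_prime[||mq|mp]; try exact: subring_nat.
  apply: (IHn q) => //; last by apply: contra_neq N_neq0 => q0; rewrite -NE q0.
  by have := prime_gt1 pr; nia.
by exists (pdiv N).
Qed.

End LocalRing.

(** * The normalization *)

Section Normalization.
Variables (L : fieldExtType rat) (R : L -> Prop).
Hypothesis subR : is_subring R.
Let S := normalization R.
(** The ring of integers of the number field Frac R. *)
Let O x := frac R x /\ integralOver (intr : int -> L) x.

Lemma normalization_subring : is_subring S.
Proof.
have [F0 F1 FB FD FM] := frac_subring subR.
have intP := integral_overP subR.
split.
- by split=> //; apply/intP; apply: integral0.
- by split=> //; apply/intP; apply: integral1.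
- move=> x y [Fx /intP ix] [Fy /intP iy]; split; first exact: FB.
  by apply/intP; apply: integral_sub.
- move=> x y [Fx /intP ix] [Fy /intP iy]; split; first exact: FD.
  by apply/intP; apply: integral_add.
move=> x y [Fx /intP ix] [Fy /intP iy]; split; first exact: FM.
by apply/intP; apply: integral_mul.
Qed.

Lemma sub_normalization x : R x -> S x.
Proof.
move=> Rx; split; first exact: sub_frac.
have Rx' : x \in subring_pred subR by apply/asboolP.
by apply/(integral_overP subR); apply: (integral_id (subring_val subR) (Sub x Rx')).
Qed.

(** The generators from [ex_integral_denominator] may lie outside Frac R. Projection onto the
    rational span U of R fixes y and sends them to elements with nonzero integer multiples in R. *)
Lemma integral_int_multiplier :
  exists c, [/\ R c, c != 0 & forall y, O y -> R (c * y)].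
Proof.
have [R0 R1 RB RD RM] := subR.
have [U [RU UR]] := ex_nat_multiple_space subR.
have [c c_neq0 [n [E EP]]] := ex_integral_denominator L.
have UE i : exists N : nat, N != 0 /\ R (N%:R * projv U (E i)).
  by have [N N_neq0 RN] := UR _ (memv_proj U (E i)); exists N.
have [N NP] := choice UE.
have RN k : R (N k)%:R by apply: subring_nat.
have Rprod (P : pred 'I_n) : R (\prod_(i | P i) (N i)%:R) by apply: big_ind.
exists (c%:~R * \prod_i (N i)%:R); split.
- by apply: RM => //; apply: subring_int.
- rewrite mulf_neq0 ?intrL_eq0 //; apply/prodf_neq0 => i _.
  by rewrite pmulrn intrL_eq0; case: (NP i).
move=> y [fy /EP[z yE]].
have Uy : y \in U.
  have [M M_neq0 /RU UMy] := frac_nat_multiple subR fy.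
  have -> : y = (M%:R^-1 : rat) *: (M%:R * y).
    rewrite -(rmorph_nat (in_alg L)) mulr_algl scalerA mulVf ?scale1r //.
    by rewrite pnatr_eq0.
  exact: memvZ.
have -> : c%:~R * \prod_i (N i)%:R * y = \prod_i (N i)%:R * projv U (c%:~R * y).
  by rewrite projv_id; [ring|rewrite mulrzl rpredMz].
rewrite yE linear_sum mulr_sumr; apply: (subgroup_sum (subring_subgroup subR)) => i _.
rewrite (bigD1 i) //= mulrzl raddfMz -mulrzl.
set P := \prod_(j | _) _; pose w := projv U (E i); rewrite -[X in _ * X]/(_ * w).
have -> : (N i)%:R * P * ((z i)%:~R * w) = P * (z i)%:~R * ((N i)%:R * w) by ring.
apply: (RM); last by case: (NP i).
by apply: (RM); [apply: Rprod|apply: subring_int].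
Qed.

Variable m : L -> Prop.
Hypotheses (locR : is_local R) (maxm : maximal_ideal R m).
Variable q : nat.
Hypotheses (q_pr : prime q) (mq : m q%:R).

Lemma int_unit (z : int) : ~~ (q%:Z %| z)%Z -> exists2 y, R y & z%:~R * y = 1.
Proof.
move=> ndvd; apply: (local_unit subR locR maxm); first exact: subring_int.
move=> mz; have cop : coprimez q z by rewrite coprimezE prime_coprime.
have [[u v] /= uv1] : {uv | uv.1 * q%:Z + uv.2 * z = 1}.
  by case: (egcdzP q z) => u v; rewrite (eqP cop) => ? _; exists (u, v).
have [_ m1 _] := maxm; apply: m1.
rewrite -[1](_ : 1%:~R = 1) // -uv1 intrD !intrM.
apply: (subgroupD (maximal_subgroup subR maxm)).
  by apply: (maximalMl maxm) => //; apply: subring_int.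
by apply: (maximalMl maxm) => //; apply: subring_int.
Qed.

(* Some coefficient of a primitive integral relation for [y] is a unit of [R];
   it is the difference of two consecutive Horner tails. *)
Lemma comaximal_pair y : frac R y ->
  exists r u v, [/\ R r, u + v * y = r, exists2 s, R s & r * s = 1,
    O u & O (u * y) /\ O v].
Proof.
move=> Fy; have [p [p_neq0 cp1 py0]] := ex_primitive_relation y.
have [i ndvd] := zprimitive_coef q_pr cp1.
have [s Rs rs1] := int_unit ndvd.
set P := map_poly intr p in py0.
have intP k : integralOver (intr : int -> L) P`_k by rewrite coef_map; apply: integral_id.
have FP k : frac R P`_k by rewrite coef_map /=; apply: (sub_frac subR); apply: subring_int.
have OH k : O (drop_poly k P).[y].
  split; last exact: integral_horner_drop.
  by apply: (subring_horner (frac_subring subR)) => // j; rewrite coef_drop_poly; apply: FP.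
have [F0 F1 FB FD FM] := frac_subring subR.
exists (p`_i)%:~R, (drop_poly i P).[y], (- (drop_poly i.+1 P).[y]); split.
- exact: subring_int.
- rewrite horner_drop_polyS coef_map /=; ring.
- by exists s.
- exact: OH.
split; last first.
  have [FH intH] := OH i.+1; split; first by apply: (subgroupN (subring_subgroup (frac_subring subR))).
  exact: integral_opp.
(* For i = 0 the tail u is P(y) = 0; otherwise u y is the preceding tail minus a coefficient. *)
case: i ndvd rs1 => [|i] _ _.
  rewrite drop_poly0l (eqP py0) mul0r; split=> //; exact: integral0.
have -> : (drop_poly i.+1 P).[y] * y = (drop_poly i P).[y] - P`_i.
  by rewrite [in RHS]horner_drop_polyS; ring.
have [FH intH] := OH i; split; first exact: FB.
exact: integral_sub.
Qed.

Lemma integral_normalization x : O x -> S x.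
Proof. by case=> Fx ix; split=> //; apply: subring_integral_int. Qed.

(** A Prüfer condition: a generates (a, b) where u is invertible, b does where 1 - u is. It is
    [comaximal_pair] at b / a, divided by the unit r. *)
Lemma normalization_pair a b : frac R a -> frac R b ->
  exists u s t, [/\ S u, S s, S t, u * b = a * s & (1 - u) * a = b * t].
Proof.
have [S0 S1 SB SD SM] := normalization_subring.
move=> Fa Fb; have [->|a_neq0] := eqVneq a 0.
  by exists 0, 0, 0; split; rewrite ?mulr0 ?mul0r.
have [r [u [v [Rr uvr [s Rs rs1] Ou [Ouy Ov]]]]] := comaximal_pair (frac_mul subR Fb (frac_inv subR Fa)).
have SO x : O x -> S (s * x).
  by move=> Ox; apply: SM; [apply: sub_normalization|apply: integral_normalization].
exists (s * u), (s * (u * (b / a))), (s * v); split; try exact: SO.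
  by field.
have -> : (1 - s * u) * a = (r * s - s * u) * a by rewrite rs1.
by rewrite -uvr; field.
Qed.

(* [B] below is stable under [R] and [O], and an integral equation for [y]
   expresses [v ^ (n - 1) y ^ n] with [u + v y = 1] in terms of them. *)
Lemma ex_conductor : exists c, [/\ R c, c != 0 & forall y, S y -> R (c * y)].
Proof.
have [R0 R1 RB RD RM] := subR.
have [F0 F1 FB FD FM] := frac_subring subR.
have [c [Rc c_neq0 cO]] := integral_int_multiplier.
exists c; split=> // y [Fy [p [mon_p Rp py0]]].
(* The x with c x O inside R; by the choice of c, 1 is one of them. *)
pose B x := forall o, O o -> R (c * (x * o)).
have OM x z : O x -> O z -> O (x * z).
  move=> [Fx ix] [Fz iz]; split; [exact: FM|exact: (@integral_mul _ _ intr)].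
have sB : subgroup B.
  split=> [o _|x z Bx Bz o Oo]; first by rewrite mul0r mulr0.
  by rewrite mulrBl mulrBr; apply: RB; [apply: Bx|apply: Bz].
have BR r x : R r -> B x -> B (r * x).
  by move=> Rr Bx o Oo; rewrite -mulrA mulrCA; apply: RM => //; apply: Bx.
have BO o x : O o -> B x -> B (o * x).
  move=> Oo Bx o' Oo'; have -> : o * x * o' = x * (o * o') by ring.
  by apply: Bx; apply: OM.
have O1 : O 1 by split=> //; apply: integral1.
have B1 : B 1 by move=> o Oo; rewrite mul1r; apply: cO.
suff By : B y by have := By 1 O1; rewrite mulr1.
have [r [u0 [v0 [Rr uvr [s Rs rs1] Ou [Ouy Ov]]]]] := comaximal_pair Fy.
pose u := s * u0; pose v := s * v0.
have uv1 : u = 1 - v * y by rewrite -rs1 -uvr /u /v; ring.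
have Bv x : B x -> B (v * x) by move=> Bx; rewrite /v -mulrA; apply: BR => //; apply: BO.
have Bu x : B x -> B (u * x) by move=> Bx; rewrite /u -mulrA; apply: BR => //; apply: BO.
have Buy : B (u * y).
  by rewrite /u -mulrA -[u0 * y]mulr1; apply: BR => //; apply: BO.
clearbody u v.
have Bvy x : B x -> B (v * y * x).
  move=> Bx; have -> : v * y * x = x - u * x by rewrite uv1; ring.
  by apply: sB.2 => //; apply: Bu.
have BX (f : L) k x : (forall z, B z -> B (f * z)) -> B x -> B (f ^+ k * x).
  by move=> Bf Bx; elim: k => [|k IHk]; rewrite ?expr0 ?mul1r // exprS -mulrA; apply: Bf.
have [n szp] : exists n, size p = n.+1.
  by exists (size p).-1; rewrite prednK // size_poly_gt0 monic_neq0.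
case: n => [|n] in szp.
  move: py0; rewrite (size1_polyC (eq_leq szp)) rootC.
  by have := monicP mon_p; rewrite lead_coefE szp => ->; rewrite oner_eq0.
(* Here p has degree n + 1, and p(y) = 0 is multiplied by v^n. *)
have Btop : B ((v * y) ^+ n * y).
  have -> : (v * y) ^+ n * y = - \sum_(i < n.+1) p`_i * (v ^+ (n - i) * ((v * y) ^+ i * 1)).
    apply/eqP; rewrite -addr_eq0; apply/eqP.
    transitivity (v ^+ n * p.[y]); last by rewrite (eqP py0) mulr0.
    rewrite horner_coef szp [in RHS]big_ord_recr /= mulrDr addrC; congr (_ + _); last first.
      have := monicP mon_p; rewrite lead_coefE szp /= => ->; rewrite mul1r exprMn exprSr; ring.
    rewrite mulr_sumr; apply: eq_bigr => i _.
    have le_in : (i <= n)%N by rewrite -ltnS.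
    have -> : v ^+ n = v ^+ (n - i) * v ^+ i by rewrite -exprD subnK.
    by rewrite exprMn; ring.
  apply: (subgroupN sB); apply: (subgroup_sum sB) => i _.
  by apply: BR => //; apply: (BX) => //; apply: (BX).
have {Btop} : B (y - (1 - (v * y) ^+ n) * y).
  by have -> : y - (1 - (v * y) ^+ n) * y = (v * y) ^+ n * y by ring.
(* As u = 1 - v y, this is a geometric sum in v y, times u y. *)
have Bdiff : B ((1 - (v * y) ^+ n) * y).
  have -> : (1 - (v * y) ^+ n) * y = \sum_(i < n) (v * y) ^+ i * (u * y).
    rewrite -mulr_suml mulrA -opprB subrX1 uv1; ring.
  by apply: (subgroup_sum sB) => i _; apply: BX.
by move/(subgroupD sB)/(_ Bdiff); rewrite subrK.
Qed.

End Normalization.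

(** * Finiteness modulo a prime *)

Definition mulset (F : nzRingType) (c : F) (A : F -> Prop) : F -> Prop :=
  fun x => exists2 y, A y & x = c * y.

Definition extend (T : Type) (r : nat) (a : T) (x : 'I_r -> T) (i : 'I_r.+1) : T :=
  if unlift ord0 i is Some j then x j else a.

Lemma sum_extend (F : nzRingType) (r : nat) (a : F) (x : 'I_r -> F) (z : 'I_r.+1 -> F) :
  \sum_(i < r.+1) z i * extend a x i = z ord0 * a + \sum_(i < r) z (lift ord0 i) * x i.
Proof.
rewrite big_ord_recl /extend unlift_none; congr (_ + _).
by apply: eq_bigr => i _; rewrite liftK.
Qed.

Section ScaledSubgroups.
Variable F : fieldType.
Implicit Types A B : F -> Prop.

Lemma mulset_subgroup c A : subgroup A -> subgroup (mulset c A).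
Proof.
move=> [A0 AB]; split; first by exists 0; rewrite ?mulr0.
by move=> _ _ [x Ax ->] [y Ay ->]; exists (x - y); rewrite ?mulrBr //; apply: AB.
Qed.

Lemma covering_sub A A' B B' (T : finType) (s : T -> F) :
    (forall x, A' x -> A x) -> (forall x, B x -> B' x) ->
  covering A B s -> covering A' B' s.
Proof. by move=> AA' BB' cov a /AA'/cov[t /BB']; exists t. Qed.

Lemma covering_mulset c A B (T : finType) (s : T -> F) :
  covering A B s -> covering (mulset c A) (mulset c B) (fun t => c * s t).
Proof.
move=> cov _ [a /cov[t Bt] ->]; exists t; exists (a - s t) => //.
by rewrite mulrBr.
Qed.

Lemma transversal_mulset c A B (T : finType) (s : T -> F) : c != 0 ->
  transversal A B s -> transversal (mulset c A) (mulset c B) (fun t => c * s t).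
Proof.
move=> c_neq0 [[As sinj] cov]; split; last exact: covering_mulset.
split=> [t|t u [y By]]; first by exists (s t).
by rewrite -mulrBr => /(mulfI c_neq0) eqy; apply: sinj; rewrite eqy.
Qed.

Lemma covering_expn c A (T : finType) (s : T -> F) k :
  covering A (mulset c A) s ->
  exists (U : finType) (u : U -> F), covering A (mulset (c ^+ k) A) u.
Proof.
move=> cov; elim: k => [|k [U [u covu]]].
  exists unit, (fun=> 0) => a Aa; exists tt; exists a => //.
  by rewrite expr0 mul1r subr0.
exists (U * T)%type, (fun p => u p.1 + c ^+ k * s p.2).
apply: (covering_trans (u := fun t => c ^+ k * s t) covu).
apply: (covering_sub _ _ (covering_mulset (c := c ^+ k) cov)) => // x.
by case=> z [y Ay ->] ->; exists y; rewrite // exprSr mulrA.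
Qed.

End ScaledSubgroups.

(* A family independent modulo [q] is linearly independent over the rationals,
   by clearing denominators; hence A / qA has dimension at most that of [L]. *)
Lemma ex_covering_mod_prime (L : fieldExtType rat) (A : L -> Prop) (q : nat) :
    subgroup A -> prime q ->
  exists (T : finType) (s : T -> L), covering A (mulset q%:R A) s.
Proof.
move=> sA q_pr.
have AZ (z : int) x : A x -> A (z%:~R * x).
  move=> Ax; have AN k : A (k%:R * x).
    elim: k => [|k IHk]; first by rewrite mul0r; apply: sA.1.
    by rewrite -natr1 mulrDl mul1r; apply: (subgroupD sA).
  case: z => k; first by rewrite -pmulrn.
  by rewrite NegzE mulrNz -pmulrn mulNr; apply: (subgroupN sA).
have sqA : subgroup (mulset q%:R A) by apply: mulset_subgroup.
pose P r := exists2 x : 'I_r -> L, (forall i, A (x i)) &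
  forall z : 'I_r -> int, mulset q%:R A (\sum_i (z i)%:~R * x i) -> forall i, (q%:Z %| z i)%Z.
have [||r [x Ax xfree] nP] := @ex_max_nat P (\dim {:L}).
- by exists (fun=> 0) => [i|z _ []//]; apply: sA.1.
- move=> r [x Ax xfree]; pose X := [tuple x i | i < r].
  have XE (i : 'I_r) : X`_i = x i by rewrite -tnth_nth tnth_mktuple.
  suff : free X.
    by rewrite /free size_tuple => /eqP <-; apply: dimvS (subvf _).
  (* Packing the coefficients into a polynomial lets the content be divided out; independence then
     makes q divide every coefficient of a primitive polynomial. *)
  apply/freeP => k k0; pose K := \poly_(i < r) oapp k 0 (insub i).
  have KE (i : 'I_r) : K`_i = k i by rewrite coef_poly ltn_ord valK.
  have [K0 i|K_neq0] := eqVneq K 0; first by rewrite -KE K0 coef0.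
  have [p [a a_neq0 Kp]] := rat_poly_scale K.
  have p_neq0 : p != 0 by apply: contraNneq K_neq0 => p0; rewrite Kp p0 rmorph0 scaler0.
  have [] := @zprimitive_coef (zprimitive p) q q_pr; first by rewrite zcontents_primitive p_neq0.
  have cp_neq0 : (zcontents p)%:~R != 0 :> rat by rewrite intr_eq0 zcontents_eq0.
  have aQ_neq0 : a%:~R != 0 :> rat by rewrite intr_eq0.
  have zpE i : ((zprimitive p)`_i)%:~R = a%:~R / (zcontents p)%:~R * K`_i :> rat.
    have pE : (p`_i)%:~R = (zcontents p)%:~R * ((zprimitive p)`_i)%:~R :> rat.
      by rewrite -intrM {1}(zpolyEprim p) coefZ.
    rewrite Kp coefZ coef_map /= pE.
    move: (zcontents p)%:~R cp_neq0 => b b_neq0; field.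
    by rewrite aQ_neq0 b_neq0.
  have rel : \sum_(i < r) ((zprimitive p)`_i)%:~R * x i = 0.
    transitivity (\sum_(i < r) (a%:~R / (zcontents p)%:~R : rat) *: (k i *: X`_i)).
      apply: eq_bigr => i _; rewrite XE -(rmorph_int (in_alg L)) zpE KE.
      by rewrite mulr_algl scalerA.
    by rewrite -scaler_sumr k0 scaler0.
  move=> i; have [ltir|leri] := ltnP i r.
    by rewrite (xfree (fun j => (zprimitive p)`_j) _ (Ordinal ltir)) // rel; apply: sqA.1.
  have -> : (zprimitive p)`_i = 0.
    apply/eqP; rewrite -(intr_eq0 rat) zpE [K`_i]nth_default ?mulr0 //.
    exact: leq_trans (size_poly _ _) leri.
  by rewrite dvdz0.
have q_gt0 := prime_gt0 q_pr.
exists {ffun 'I_r -> 'I_q}, (fun f : {ffun 'I_r -> 'I_q} => \sum_i (f i)%:R * x i) => a Aa.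
(* By maximality of r, the family extended by a is dependent modulo qA. *)
have [z [az nz]] : exists z : 'I_r.+1 -> int,
    mulset q%:R A (\sum_i (z i)%:~R * extend a x i) /\ ~ (forall i, (q%:Z %| z i)%Z).
  apply: contrapT => noz; apply: nP; exists (extend a x).
    by move=> i; rewrite /extend; case: unlift.
  by move=> z az; apply: contrapT => nz; apply: noz; exists z.
rewrite sum_extend in az.
have qA_int (w : int) y : (q%:Z %| w)%Z -> A y -> mulset q%:R A (w%:~R * y).
  by move=> /dvdzP[w' ->] Ay; exists (w'%:~R * y); [apply: AZ|rewrite intrM; ring].
have ndvd : ~~ (q%:Z %| z ord0)%Z.
  apply/negP => dvd0; apply: nz => i; case: (unliftP ord0 i) => [j ->|-> //].
  apply: (xfree (fun j => z (lift ord0 j))).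
  by have := sqA.2 _ _ az (qA_int _ _ dvd0 Aa); rewrite addrAC subrr add0r.
have cop : coprimez q (z ord0) by rewrite coprimezE prime_coprime.
have [[u v] /= uv1] : {uv | uv.1 * q%:Z + uv.2 * z ord0 = 1}.
  by case: (egcdzP q (z ord0)) => u v; rewrite (eqP cop) => ? _; exists (u, v).
have q_neq0 : q%:Z != 0 by rewrite -lt0n in q_gt0 *; case: (q) q_gt0.
have ltq (w : int) : (`|(w %% q%:Z)%Z| < q)%N.
  by have := modz_ge0 w q_neq0; have := ltz_mod w q_neq0; lia.
(* As v inverts z_0 modulo q, a is congruent to the sum of the w_i x_i modulo qA. *)
pose w i := - v * z (lift ord0 i).
exists [ffun i => Ordinal (ltq (w i))].
have -> : a - \sum_i ([ffun i => Ordinal (ltq (w i))] i)%:R * x i =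
    (u * q)%:~R * a + v%:~R * ((z ord0)%:~R * a + \sum_i (z (lift ord0 i))%:~R * x i)
    + \sum_i (w i - (w i %% q)%Z)%:~R * x i.
  have -> : (u * q)%:~R * a = a - v%:~R * ((z ord0)%:~R * a).
    have uvL : (u * q)%:~R + v%:~R * (z ord0)%:~R = 1 :> L by rewrite -intrM -intrD uv1.
    by apply/eqP; rewrite eq_sym subr_eq (mulrA v%:~R) -mulrDl uvL mul1r.
  have -> : \sum_i (w i - (w i %% q)%Z)%:~R * x i =
      - (v%:~R * \sum_i (z (lift ord0 i))%:~R * x i)
      - \sum_i ([ffun i => Ordinal (ltq (w i))] i)%:R * x i.
    rewrite mulr_sumr -!sumrN -big_split; apply: eq_bigr => i _ /=.
    rewrite ffunE /= pmulrn gez0_abs ?modz_ge0 // intrB {1}/w !intrM intrN; ring.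
  ring.
apply: (subgroupD sqA); last first.
  apply: (subgroup_sum sqA) => i _; apply: qA_int => //.
  by rewrite {1}(divz_eq (w i) q) addrK dvdz_mull.
apply: (subgroupD sqA); first by apply: qA_int => //; rewrite dvdz_mull.
by case: az => y Ay ->; exists (v%:~R * y); [apply: AZ|ring].
Qed.

(** * The counting argument *)

Section SetMul.
Variable L : fieldExtType rat.
Implicit Types A B C : L -> Prop.

Lemma set_mul_subgroup A B : subgroup A -> subgroup (set_mul A B).
Proof.
move=> sA; split; first by exists [::]; rewrite big_nil.
move=> _ _ [s [sAB ->]] [t [tAB ->]].
exists (s ++ [seq (- p.1, p.2) | p <- t]); split.
  move=> p; rewrite mem_cat => /orP[/sAB//|/mapP[p' /tAB[Ap Bp] ->]] /=.
  by split=> //; apply: (subgroupN sA).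
by rewrite big_cat big_map /= -sumrN; congr (_ + _); apply: eq_bigr => p _; rewrite mulNr.
Qed.

Lemma mem_set_mul A B a b : A a -> B b -> set_mul A B (a * b).
Proof.
move=> Aa Bb; exists [:: (a, b)]; split; last by rewrite big_seq1.
by move=> p; rewrite inE => /eqP->.
Qed.

Lemma set_mul_sub A B C :
  subgroup C -> (forall a b, A a -> B b -> C (a * b)) -> forall x, set_mul A B x -> C x.
Proof.
move=> sC AB _ [s [sAB ->]]; rewrite big_seq; apply: (subgroup_sum sC) => p /sAB[Ap Bp].
exact: AB.
Qed.

End SetMul.

Section ResidueCharacteristic.
Variables (L : fieldExtType rat) (R m : L -> Prop) (q : nat).
Hypotheses (subR : is_subring R) (locR : is_local R) (maxm : maximal_ideal R m).
Hypotheses (q_pr : prime q) (mq : m q%:R).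
Let S := normalization R.
Let mS := set_mul m S.

(** Since R / qR is finite, m is generated by q and finitely many representatives. An inverse of the
    ideal is built by adding generators one at a time, starting from q with 1/q. *)
Lemma maximal_normalization_inverse :
  exists ws : seq (L * L), [/\ \sum_(p <- ws) p.1 * p.2 = 1 &
    forall p, p \in ws -> m p.1 /\ forall x, m x -> S (x * p.2)].
Proof.
have subS := normalization_subring subR; have [S0 S1 SB SD SM] := subS.
have [R0 R1 RB RD RM] := subR.
have q_neq0 : q%:R != 0 :> L.
  by rewrite pmulrn intrL_eq0; case: (q) (prime_gt0 q_pr).
pose good (gs : seq L) := exists ws : seq (L * L), [/\ \sum_(p <- ws) p.1 * p.2 = 1 &
    forall p, p \in ws -> p.1 \in gs /\ forall x, x \in gs -> S (x * p.2)].
have goodall gs : (forall x, x \in gs -> m x) -> good (q%:R :: gs).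
  elim: gs => [|b gs IHgs] mgs.
    exists [:: (q%:R, q%:R^-1)]; rewrite big_seq1 divff //; split=> // p.
    rewrite inE => /eqP-> /=; split=> [|x]; first by rewrite inE.
    by rewrite inE => /eqP->; rewrite divff.
  have mgs' x : x \in q%:R :: gs -> m x.
    by rewrite inE => /orP[/eqP->//|xgs]; apply: mgs; rewrite inE xgs orbT.
  have mb : m b by apply: mgs; rewrite mem_head.
  have [|ws [ws1 wsP]] := IHgs; first by move=> x xgs; apply: mgs'; rewrite inE xgs orbT.
  have Fm x : m x -> frac R x by move=> mx; apply: (sub_frac subR); apply: (maximal_sub maxm).
  have pair (p : L * L) : exists ust : L * L * L, p \in ws ->
      [/\ S ust.1.1, S ust.1.2, S ust.2, ust.1.1 * b = p.1 * ust.1.2 &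
          (1 - ust.1.1) * p.1 = b * ust.2].
    have [pws|npws] := boolP (p \in ws); last by exists (0, 0, 0).
    have [/mgs' mp _] := wsP _ pws.
    have [u [s [t H]]] := normalization_pair subR locR maxm q_pr mq (Fm _ mp) (Fm _ mb).
    by exists (u, s, t).
  have [f fP] := choice pair.
  (* Each a w splits as a (u w) + (1 - u) a w, and (1 - u) a w = b (t w) by the Prüfer condition for
     a and b. *)
  exists ((b, \sum_(p <- ws) p.2 * (f p).2) :: [seq (p.1, p.2 * (f p).1.1) | p <- ws]).
  split.
    rewrite big_cons big_map /= -ws1 mulr_sumr -big_split /= !big_seq.
    apply: eq_bigr => p pws; have [_ _ _ _ H] := fP _ pws.
    have -> : b * (p.2 * (f p).2) = p.2 * (b * (f p).2) by ring.
    by rewrite -H; ring.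
  have memE x : x \in [:: q%:R, b & gs] -> x = b \/ x \in q%:R :: gs.
    by rewrite !inE => /or3P[->|/eqP->|->]; rewrite ?orbT; [right|left|right].
  move=> p; rewrite inE => /orP[/eqP-> /=|/mapP[p' p'ws ->] /=].
    split=> [|x xgs]; first by rewrite !inE eqxx orbT.
    rewrite mulr_sumr big_seq; apply: (subgroup_sum (subring_subgroup subS)) => r rws.
    have [Su _ St _ H] := fP _ rws; have [r1 wP] := wsP _ rws.
    case: (memE _ xgs) => [->|/wP Sxr]; last by rewrite mulrA; apply: SM.
    have -> : b * (r.2 * (f r).2) = (1 - (f r).1.1) * (r.1 * r.2).
      by rewrite [RHS]mulrA H; ring.
    by apply: SM; [apply: SB|apply: wP].
  have [Su Ss _ H _] := fP _ p'ws; have [p1 wP] := wsP _ p'ws.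
  split=> [|x /memE[->|/wP Sxp]].
  - by move: p1; rewrite !inE => /orP[->//|->]; rewrite !orbT.
  - have -> : b * (p'.2 * (f p').1.1) = (f p').1.2 * (p'.1 * p'.2).
      by rewrite mulrCA [b * _]mulrC H; ring.
    by apply: SM => //; apply: wP.
  - by rewrite mulrA; apply: SM.
have [T [s cov]] := ex_covering_mod_prime (subring_subgroup subR) q_pr.
have sm := maximal_subgroup subR maxm.
have sqR := mulset_subgroup q%:R (subring_subgroup subR).
have cov' : covering m (mulset q%:R R) s.
  by apply: covering_sub cov => // x; apply: (maximal_sub maxm).
have [U [u [[[mu _] covu] _]]] := ex_transversal sm sqR cov'.
have [|ws [ws1 wsP]] := goodall [seq u i | i <- enum U].
  by move=> x /mapP[i _ ->].
have qgs : q%:R \in q%:R :: [seq u i | i <- enum U] by rewrite mem_head.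
exists ws; split=> // p /wsP[p1 wP]; split=> [|x mx].
  by move: p1; rewrite inE => /orP[/eqP->//|/mapP[i _ ->]].
have [i [r Rr xE]] := covu _ mx.
rewrite -(subrK (u i) x) xE mulrDl; apply: SD; last first.
  by apply: wP; rewrite inE map_f ?mem_enum ?orbT.
by rewrite mulrAC mulrC; apply: SM; [apply: sub_normalization|apply: wP].
Qed.

Lemma maximal_normalization_finite :
  [/\ exists (T : finType) (s : T -> L), covering R m s,
      exists (T : finType) (s : T -> L), covering S mS s &
      forall c, R c -> c != 0 -> exists (T : finType) (s : T -> L),
        covering S (mulset c mS) s].
Proof.
have subS := normalization_subring subR; have [S0 S1 SB SD SM] := subS.
have [R0 R1 RB RD RM] := subR.
have finS c : R c -> c != 0 -> exists (T : finType) (s : T -> L),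
    covering S (mulset c mS) s.
  move=> Rc c_neq0.
  have [c' Rc' [N N_neq0 cc']] := ex_nat_multiple subR Rc c_neq0.
  have N_gt0 : (0 < N)%N by rewrite lt0n.
  (* In N = u q^k the factor u is a unit of R, so q^k lies in cR. One more factor q, from m, puts
     q^(k+1) S inside c mS. *)
  have [u cop NE] := pfactor_coprime q_pr N_gt0; set k := logn q N in NE.
  have ndvd : ~~ (q%:Z %| u%:Z)%Z by rewrite dvdzE /= -prime_coprime.
  have [w Rw uw1] := int_unit subR locR maxm q_pr mq ndvd.
  have [T [s cov]] := ex_covering_mod_prime (subring_subgroup subS) q_pr.
  have [U [v covv]] := covering_expn k.+1 cov.
  exists U, v; apply: covering_sub covv => // x [y Sy ->].
  exists (q%:R * (c' * w * y)).
    by apply: mem_set_mul => //; apply: (SM) => //; apply: sub_normalization => //; apply: RM.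
  have qkE : c * c' * w = q%:R ^+ k.
    by rewrite cc' NE natrM natrX mulrAC [u%:R]pmulrn uw1 mul1r.
  by rewrite exprSr -qkE; ring.
split; last exact: finS.
  have [T [s cov]] := ex_covering_mod_prime (subring_subgroup subR) q_pr.
  exists T, s; apply: covering_sub cov => // x [y Ry ->].
  by rewrite mulrC; apply: (maximalMl maxm).
have [T [s cov]] := finS _ R1 (oner_neq0 L); exists T, s.
by apply: covering_sub cov => // x [y mSy ->]; rewrite mul1r.
Qed.

(* With [N1 = cS] inside [I], the generic polynomial [g] with coefficients in
   [m] embeds (I / N1)[X] into (mI / mN1)[X] raising degrees by a bounded
   amount, so [I : N1] <= [mI : mN1]; now compare the two chains from [I] down
   to [mN1] through [N1] and through [mI]. *)
Lemma ex_transversal_ideal_leq (I : L -> Prop) (TS : finType) (sS : TS -> L) :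
    ideal R I -> (exists2 x, I x & x != 0) -> transversal S mS sS ->
  exists (TI : finType) (sI : TI -> L),
    transversal I (set_mul m I) sI /\ (#|TI| <= #|TS|)%N.
Proof.
move=> idI [x0 Ix0 x0_neq0] trS.
have subS := normalization_subring subR; have [S0 S1 SB SD SM] := subS.
have [R0 R1 RB RD RM] := subR; have [IR I0 ID IM] := idI.
have sgI := ideal_subgroup subR idI; have sgm := maximal_subgroup subR maxm.
have sgmI : subgroup (set_mul m I) by apply: set_mul_subgroup.
have sgmS : subgroup mS by apply: set_mul_subgroup.
have sgS := subring_subgroup subS.
have RS := sub_normalization subR; have mR := maximal_sub maxm.
have [c0 [Rc0 c0_neq0 c0S]] := ex_conductor subR locR maxm q_pr mq.
(* The factor c0 carries S into R, and x0 carries R into I. *)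
pose c := c0 * x0; have c_neq0 : c != 0 by rewrite mulf_neq0.
have Rc : R c by apply: RM => //; apply: IR.
have cSI y : S y -> I (c * y).
  by move=> Sy; rewrite /c mulrAC; apply: IM => //; apply: c0S.
have mSS y : mS y -> S y.
  by apply: set_mul_sub => // a b /mR/RS Sa Sb; apply: SM.
have SmS x y : S x -> mS y -> mS (x * y).
  move=> Sx [s [sP ->]]; rewrite mulr_sumr big_seq; apply: (subgroup_sum sgmS) => p /sP[mp Sp].
  by rewrite mulrCA; apply: mem_set_mul => //; apply: SM.
have mII y : set_mul m I y -> I y.
  by apply: set_mul_sub => // a b /mR Ra Ib; apply: IM.
pose N1 := mulset c S; pose N2 := mulset c mS.
have sgN1 : subgroup N1 by apply: mulset_subgroup.
have sgN2 : subgroup N2 by apply: mulset_subgroup.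
have N1I y : N1 y -> I y by case=> z Sz ->; apply: cSI.
have N21 y : N2 y -> N1 y by case=> z /mSS Sz ->; exists z.
have N2mI y : N2 y -> set_mul m I y.
  case=> z [s [sP ->] ->]; rewrite mulr_sumr big_seq; apply: (subgroup_sum sgmI) => p /sP[mp Sp].
  by rewrite mulrCA; apply: mem_set_mul => //; apply: cSI.
have [_ _ finS] := maximal_normalization_finite.
have [T0 [s0 cov0]] := finS _ Rc c_neq0.
have covI : covering I N2 s0 by apply: covering_sub cov0 => // y /IR/RS.
have cov1 : covering I N1 s0 by apply: covering_sub covI.
have cov2 : covering (set_mul m I) N2 s0 by apply: covering_sub covI.
have covmI : covering I (set_mul m I) s0 by apply: covering_sub covI.
have [TI [sI [trI _]]] := ex_transversal sgI sgmI covmI.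
exists TI, sI; split=> //.
have [T1 [s1 [tr1 T1_gt0]]] := ex_transversal sgI sgN1 cov1.
have [T2 [s2 [tr2 T2_gt0]]] := ex_transversal sgmI sgN2 cov2.
(* Both sides are [I : N2]; multiplication by c identifies S / mS with N1 / N2. *)
have cardE : (#|T1| * #|TS| = #|TI| * #|T2|)%N.
  rewrite -!card_prod; apply: (transversal_card sgN2).
    exact: (transversal_trans sgI sgN1 N1I N21 tr1 (transversal_mulset c_neq0 trS)).
  exact: (transversal_trans sgI sgmI mII N2mI trI tr2).
have [ws [ws1 wsP]] := maximal_normalization_inverse.
pose g := Poly [seq p.1 | p <- ws].
pose w (i : 'I_(size ws)) := (nth (0, 0) ws i).2.
have gE i : g`_i = (nth (0, 0) ws i).1.
  rewrite coef_Poly; have [lti|lei] := ltnP i (size ws).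
    by rewrite (nth_map (0, 0)).
  by rewrite !nth_default ?size_map.
have mg i : m g`_i.
  rewrite gE; have [lti|lei] := ltnP i (size ws); last by rewrite nth_default //; apply: sgm.1.
  by have [] := wsP _ (mem_nth (0, 0) lti).
have wmS i x : m x -> S (w i * x).
  by rewrite mulrC; have [_ H] := wsP _ (mem_nth (0, 0) (ltn_ord i)); apply: H.
(* Division of h by c reduces this to [content_cancel] for S and mS. *)
have gN (h : {poly L}) : (forall k, N2 (g * h)`_k) -> forall k, N1 h`_k.
  move=> N2gh k; exists (c^-1 * h`_k); last by rewrite mulVKf.
  rewrite -coefZ; apply: (content_cancel (w := w) sgS sgmS SmS) => //.
  - by move=> i x Sx; apply: mem_set_mul.
  - move=> i x [s [sP ->]]; rewrite mulr_sumr big_seq.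
    apply: (subgroup_sum sgS) => p /sP[mp Sp]; rewrite mulrA; apply: SM => //.
    exact: wmS.
  - by move=> i j; apply: wmS.
  - rewrite -ws1 (big_nth (0, 0)) big_mkord; apply: eq_bigr => i _.
    by rewrite gE mulrC.
  move=> j; rewrite -scalerAr coefZ; case: (N2gh j) => y mSy ->.
  by rewrite mulKf.
have card12 := card_expn_leq sgI sgmI sgN2 (fun i x Ix => mem_set_mul (mg i) Ix) gN tr1.1 tr2.2.
(* Raise [cardE] to the power N + size g, bound #|T1|^N by [card12], and cancel the power of #|T2|;
   a factor #|T1|^(size g) is left over. *)
apply: (@leq_of_expn_leq _ _ (#|T1| ^ size g) (size g)) => N.
have := card12 N; set K := (N + size g)%N => le12.
have cardK : (#|T1| ^ K * #|TS| ^ K = #|TI| ^ K * #|T2| ^ K)%N by rewrite -!expnMn cardE.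
have T2K_gt0 : (0 < #|T2| ^ K)%N by rewrite expn_gt0 T2_gt0.
rewrite -(leq_pmul2r T2K_gt0) -cardK {1}/K expnD.
apply: (leq_trans (leq_mul (leq_mul le12 (leqnn _)) (leqnn _))).
by rewrite -mulnA mulnC [X in (X * _)%N]mulnC.
Qed.

(** A maximal independent family of length r < n would span S / mS, so that |k|^n <= |I / mI| <= |S
    / mS| <= |k|^r, although |k| > 1. *)
Lemma dim_quot_le_residue_char (I : L -> Prop) :
  ideal R I -> dim_quot_le R m I S.
Proof.
move=> idI n x [Ix xindep].
have subS := normalization_subring subR; have [S0 S1 SB SD SM] := subS.
have [R0 R1 RB RD RM] := subR; have [IR I0 ID IM] := idI.
have sgI := ideal_subgroup subR idI; have sgm := maximal_subgroup subR maxm.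
have sgmI : subgroup (set_mul m I) by apply: set_mul_subgroup.
have sgmS : subgroup mS by apply: set_mul_subgroup.
have sgR := subring_subgroup subR; have sgS := subring_subgroup subS.
have RS := sub_normalization subR; have mR := maximal_sub maxm.
have [_ m1 _] := maxm.
pose P r := (r <= n)%N /\ exists y : 'I_r -> L, indep_mod R m S mS y.
have [||r [le_rn [y [Sy yindep]]] nP] := @ex_max_nat P n.
- by split=> //; exists (fun=> 0); split=> [[]|z _ _ []].
- by move=> k [].
have [eqrn|neqrn] := eqVneq r n; first by rewrite -eqrn; exists y.
have lt_rn : (r < n)%N by rewrite ltn_neqAle neqrn.
have [[T0 [s0 cov0]] [T1 [s1 cov1]] finS] := maximal_normalization_finite.
have [K [s [[[Rs sinj] covs] _]]] := ex_transversal sgR sgm cov0.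
have [TS [sS [trS _]]] := ex_transversal sgS sgmS cov1.
(* As n > 0 there is an x_0, and x_0 = 0 would admit the coefficient 1 in a relation. *)
have x0_neq0 : exists2 z, I z & z != 0.
  pose i0 := Ordinal (leq_ltn_trans (leq0n r) lt_rn); exists (x i0) => //.
  apply/eqP => xi0; apply: m1.
  have := xindep (fun i => (i == i0)%:R); move=> /(_ _ _ i0); rewrite eqxx; apply.
    by move=> i; apply: subring_nat.
  rewrite (bigD1 i0) //= xi0 mulr0 add0r big1; first exact: sgmI.1.
  by move=> i /negPf->; rewrite mul0r.
have K_gt1 : (1 < #|K|)%N.
  rewrite -card_bool; apply: (separated_covering_leq (s := fun b : bool => b%:R) sgm _ covs).
  split=> [b|[] [] //=]; first exact: subring_nat.
    by rewrite subr0 => /m1.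
  by rewrite sub0r => /(subgroupN sgm); rewrite opprK => /m1.
have sepI : separated I (set_mul m I) (fun f : {ffun 'I_n -> K} => \sum_i s (f i) * x i).
  split=> [f|f f']; first by apply: (subgroup_sum sgI) => i _; apply: IM.
  rewrite -sumrB => mIff; apply/ffunP => i; apply: sinj.
  apply: (xindep (fun i => s (f i) - s (f' i))) => [j|]; first exact: RB.
  by under eq_bigr => j _ do rewrite mulrBl.
have covS : covering S mS (fun f : {ffun 'I_r -> K} => \sum_i s (f i) * y i).
  move=> a Sa.
  have [z [Rz [az nz]]] : exists z : 'I_r.+1 -> L, (forall i, R (z i)) /\
      (mS (\sum_i z i * extend a y i) /\ ~ (forall i, m (z i))).
    apply: contrapT => noz; apply: nP; split=> //; exists (extend a y); split.
      by move=> i; rewrite /extend; case: unlift.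
    by move=> z Rz az; apply: contrapT => nz; apply: noz; exists z.
  rewrite sum_extend in az.
  (* Otherwise independence of y would put all coefficients in m. *)
  have nmz0 : ~ m (z ord0).
    move=> mz0; apply: nz => i; case: (unliftP ord0 i) => [j ->|-> //].
    apply: (yindep (fun j => z (lift ord0 j))) => //.
    by have := sgmS.2 _ _ az (mem_set_mul mz0 Sa); rewrite addrAC subrr add0r.
  have [v Rv zv1] := local_unit subR locR maxm (Rz ord0) nmz0.
  have RN t : R t -> R (- t) by apply: (subgroupN sgR).
  have covz (i : 'I_r) : exists t, m (- v * z (lift ord0 i) - s t).
    by apply: covs; apply: RM => //; apply: RN.
  have [f fP] := choice covz; exists (finfun f).
  have -> : a - \sum_i s (finfun f i) * y i =
      v * (z ord0 * a + \sum_i z (lift ord0 i) * y i)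
      + \sum_i (- v * z (lift ord0 i) - s (f i)) * y i.
    have -> : v * (z ord0 * a + \sum_i z (lift ord0 i) * y i) =
        a + \sum_i v * z (lift ord0 i) * y i.
      rewrite mulrDr mulrA [v * _]mulrC zv1 mul1r mulr_sumr; congr (_ + _).
      by apply: eq_bigr => i _; rewrite mulrA.
    rewrite -addrA -big_split -sumrN; congr (_ + _); apply: eq_bigr => i _ /=.
    by rewrite ffunE; ring.
  apply: (subgroupD sgmS).
    case: az => l [lP ->]; rewrite mulr_sumr big_seq.
    apply: (subgroup_sum sgmS) => p /lP[mp Sp]; rewrite mulrA.
    by apply: mem_set_mul => //; apply: (maximalMl maxm).
  by apply: (subgroup_sum sgmS) => i _; apply: mem_set_mul.
have [TI [sI [trI leTI]]] := ex_transversal_ideal_leq idI x0_neq0 trS.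
have leI := separated_covering_leq sgmI sepI trI.2.
have leS := separated_covering_leq sgmS trS.1 covS.
have := leq_trans leI (leq_trans leTI leS).
by rewrite !card_ffun !card_ord leq_exp2l // leqNgt lt_rn.
Qed.

End ResidueCharacteristic.

(** * Reduction to nonzero m, and the case m = 0 *)

Theorem theorem5p5 (L : fieldExtType rat) (R m : L -> Prop) :
  is_subring R -> is_local R -> maximal_ideal R m ->
  forall I : L -> Prop, ideal R I ->
  dim_quot_le R m I (normalization R).
Proof.
move=> subR locR maxm I idI.
have [[x mx x_neq0]|m0] := pselect (exists2 x, m x & x != 0).
  have [q q_pr mq] := ex_residue_char subR locR maxm mx x_neq0.
  exact: (dim_quot_le_residue_char subR locR maxm q_pr mq).
have {}m0 x : m x -> x = 0.
  by move=> mx; apply: contrapT => /eqP x_neq0; apply: m0; exists x.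
have [R0 R1 RB RD RM] := subR; have [_ m1 _] := maxm.
have set_mul0 (M : L -> Prop) x : set_mul m M x -> x = 0.
  case=> s [sP ->]; rewrite big_seq big1 // => p /sP[/m0-> _].
  by rewrite mul0r.
have m_0 : m 0 := (maximal_subgroup subR maxm).1.
have mM0 (M : L -> Prop) : set_mul m M 0 by exists [::]; rewrite big_nil.
have [IR _ _ _] := idI.
(* For n = 1 the family 1 works. For n >= 2 the relation x_1 x_0 - x_0 x_1 = 0 forces x_1 = 0, and
   then x_1 may take the coefficient 1, against independence. *)
case=> [|[|n]] x [Ix xindep].
- by exists (fun=> 0); split=> [[]|z _ _ []].
- exists (fun=> 1); split=> [_|z Rz /set_mul0]; first exact: sub_normalization.
  by rewrite big_ord1 mulr1 => z0 i; rewrite (ord1 i) z0.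
have Rx i : R (x i) by apply: IR.
have RN t : R t -> R (- t) by apply: (subgroupN (subring_subgroup subR)).
pose i1 : 'I_n.+2 := lift ord0 ord0.
have x1_0 : x i1 = 0.
  apply: m0; have := xindep (fun i => if i == ord0 then x i1 else if i == i1 then - x ord0 else 0).
  move=> /(_ _ _ ord0) /=; apply.
    by move=> i; case: ifP => _; [|case: ifP => _]; rewrite //; apply: RN.
  rewrite big_ord_recl big_ord_recl /= big1 => [|i _]; last by rewrite mul0r.
  by rewrite addr0 mulNr mulrC subrr; apply: mM0.
exfalso; apply: m1; have := xindep (fun i => (i == i1)%:R) _ _ i1; rewrite eqxx; apply.
  by move=> i; apply: subring_nat.
rewrite (bigD1 i1) //= x1_0 mulr0 add0r big1 => [|i /negPf->]; last by rewrite mul0r.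
exact: mM0.
Qed.
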